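(* There exists an epistemic action $X\in\mathrm{Post}$ for which there is no equivalent attention action $Y\in\mathrm{ALL}$.
   Context: Language. $I\neq\emptyset$ is a finite set of agents, $N\in\mathbb{N}=\{0,1,2,\dots\}$ an attention bound, $\Phi$ a countable set of proposition atoms, $\Psi=\{(\alpha_i<n),(\alpha_i=n): n\le N, i\in I\}$ the set of attention atoms, $At=\Phi\uplus\Psi$. The language $\mathcal{L}$ is $\varphi::=\top\mid p\mid\neg\varphi\mid\varphi\wedge\varphi\mid K_i\varphi$ with $p\in At$, $i\in I$. Attention states. An attention model is $M=(W,R,V,A)$ with $W\ne\emptyset$ a finite set of worlds; $R$ assigning to each $i\in I$ an equivalence relation $R_i$ on $W$; $V:At\to\mathcal{P}(W)$ a valuation; and $A:I\times W\to\{0,\dots,N\}$ such that $wR_iv$ implies $A_i(w)=A_i(v)$. For $w\in W$, $(M,w)$ is an attention state. Satisfaction: $M,w\vDash p$ iff $w\in V(p)$ for $p\in\Phi$; $M,w\vDash(\alpha_i=n)$ iff $A_i(w)=n$; $M,w\vDash(\alpha_i<n)$ iff $A_i(w)<n$; $M,w\vDash K_i\varphi$ iff $M,v\vDash\varphi$ for all $v$ with $wR_iv$; standard clauses for $\top,\neg,\wedge$. Write $\varphi\vDash\psi$ if every attention state satisfies $\varphi\to\psi$. Attention actions. An attention action model is $\mathcal{A}=(E,Q,Q^*,pre,c)$ with $E\neq\emptyset$ a finite set of events; $Q,Q^*$ assigning to each $i\in I$ equivalence relations $Q_i,Q_i^*$ on $E$; $pre:E\to\mathcal{L}$; and a cost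 function $c:I\times\mathcal{L}\times E\to\mathbb{N}$ with $c_i(\top,e)=0$ and such that $(e,e')\in Q_i\cup Q_i^*$ implies $c_i(\varphi,e)=c_i(\varphi,e')$, for all $i,\varphi$. A question map is a map $\mathsf{q}:I\to\mathcal{L}$. An attention action is a triple $X=(\mathcal{A},\mathsf{q},e)$ with $e\in E$. $\mathrm{ALL}$ is the class of all attention actions. Attention update. Let $Q_i^*[\varphi|\neg\varphi]$ be the set of $(e,e')\in Q_i^*$ such that ($pre(e)\vDash\varphi$ iff $pre(e')\vDash\varphi$). The update of $(M,w)=((W,R,V,A),w)$ with $X=((E,Q,Q^*,pre,c),\mathsf{q},e)$ is $(M,w)^X=((W^X,R^X,V^X,A^X),(w,e))$, where $W^X=\{(v,f)\in W\times E: M,v\vDash pre(f)\}$; $((v,f),(u,g))\in R_i^X$ iff $(v,u)\in R_i$ and $(f,g)\in Q_i\cup Q_i^*$ in case $c_i(\mathsf{q}_i,f)>A_i(v)$, respectively $(f,g)\in Q_i\cup Q_i^*[\mathsf{q}_i|\neg\mathsf{q}_i]$ in case $c_i(\mathsf{q}_i,f)\le A_i(v)$; $V^X(p)=\{(v,f)\in W^X: v\in V(p)\}$ for $p\in\Phi$; $A_i^X(v,f)=\max\{0,A_i(v)-c_i(\mathsf{q}_i,f)\}$. $X$ is applicable to $(M,w)$ if $M,w\vDash pre(e)$. Epistemic states and actions. An epistemic Kripke model is $K=(W,R,V)$ with $W\neq\emptyset$ finite, each $R_i$ an equivalence relation on $W$, and $V:At\to\mathcal{P}(W)$; $(K,w)$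 with $w\in W$ is an epistemic state; satisfaction is standard, with $K,w\vDash p$ iff $w\in V(p)$ for all $p\in At$. The Kripke rendition of $(M,w)=((W,R,V,A),w)$ is $K(M,w)=((W,R,V_A),w)$ with $V_A(p)=\{v\in W:M,v\vDash p\}$ for all $p\in At$. An action model is $\mathcal{E}=(E,Q,pre,post)$ with $E\ne\emptyset$ finite, each $Q_i$ ($i\in I$) an equivalence relation on $E$, $pre:E\to\mathcal{L}$, $post:E\to(At\to\mathcal{L})$. An epistemic action is $(\mathcal{E},e)$ with $e\in E$. $\mathrm{Post}$ is the class of all epistemic actions. The product update of $(K,w)$ with $X=(\mathcal{E},e)$ is $(K,w)^X=((W^X,R^X,V^X),(w,e))$ with $W^X=\{(v,f)\in W\times E:K,v\vDash pre(f)\}$, $((v,f),(u,g))\in R^X_i$ iff $(v,u)\in R_i$ and $(f,g)\in Q_i$, $V^X(p)=\{(v,f)\in W^X:K,v\vDash post(f)(p)\}$. $X$ is applicable to $(K,w)$ if $K,w\vDash pre(e)$. Equivalence. $Y\in\mathrm{ALL}$ and $X\in\mathrm{Post}$ are equivalent iff for all attention states $(M,w)$ and all $\varphi\in\mathcal{L}$: $(M,w)^Y\vDash\varphi$ iff $(K(M,w))^X\vDash\varphi$ (with the convention that the result of a non-applicable update satisfies no formula). *)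

(* Defs.v *)
From mathcomp Require Import all_boot.
From mathcomp Require Import boolp.

Set Implicit Arguments.
Unset Strict Implicit.
Unset Printing Implicit Defensive.

Inductive atom (I : finType) (N : nat) (Phi : countType) : Type :=
  | PropAtom of Phi
  | AttLt of I & 'I_N.+1
  | AttEq of I & 'I_N.+1.

Inductive formula (I : finType) (N : nat) (Phi : countType) : Type :=
  | Top
  | Atom of atom I N Phi
  | Neg of formula I N Phi
  | And of formula I N Phi & formula I N Phi
  | Know of I & formula I N Phi.

Arguments Top {I N Phi}.

(* [tr p w] is the truth value of the atom [p] at [w]; the semantics over
   attention structures and over Kripke structures differ only there. *)
Fixpoint sat (I : finType) (N : nat) (Phi : countType) (W : finType)
    (R : I -> rel W) (tr : atom I N Phi -> pred W)
    (w : W) (phi : formula I N Phi) : bool :=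
  match phi with
  | Top => true
  | Atom p => tr p w
  | Neg psi => ~~ sat R tr w psi
  | And psi chi => sat R tr w psi && sat R tr w chi
  | Know i psi => [forall v, R i w v ==> sat R tr v psi]
  end.

(* Structures are raw data; the conditions making them models are separate
   predicates.  Updates are thus defined without presupposing that they preserve
   these conditions: [Q_i] united with [Q*_i] need not be transitive, so the
   accessibility relations of an attention update need not be either. *)
Record att_structure (I : finType) (N : nat) (Phi : countType) : Type :=
  AttStructure {
    att_world : finType;
    att_rel : I -> rel att_world;
    att_val : atom I N Phi -> {set att_world};
    att_level : I -> att_world -> 'I_N.+1
  }.

Definition att_model (I : finType) (N : nat) (Phi : countType)
    (M : att_structure I N Phi) : Prop :=
  [/\ 0 < #|att_world M|,
      forall i, equivalence_rel (att_rel (a := M) i)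
    & forall i (w v : att_world M),
        att_rel i w v -> att_level i w = att_level i v].

(* The valuation is only consulted on propositional atoms. *)
Definition att_atom (I : finType) (N : nat) (Phi : countType)
    (M : att_structure I N Phi) (p : atom I N Phi) (w : att_world M) : bool :=
  match p with
  | PropAtom _ => w \in att_val M p
  | AttLt i n => att_level i w < n
  | AttEq i n => att_level i w == n
  end.

Definition att_sat (I : finType) (N : nat) (Phi : countType)
    (M : att_structure I N Phi) (w : att_world M)
    (phi : formula I N Phi) : bool :=
  sat (att_rel (a := M)) (att_atom (M := M)) w phi.

Definition entails (I : finType) (N : nat) (Phi : countType)
    (phi psi : formula I N Phi) : Prop :=
  forall M : att_structure I N Phi, att_model M ->
  forall w : att_world M, att_sat w phi -> att_sat w psi.

Record att_action_model (I : finType) (N : nat) (Phi : countType) : Type :=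
  AttActionModel {
    att_event : finType;
    att_Q : I -> rel att_event;
    att_Qstar : I -> rel att_event;
    att_pre : att_event -> formula I N Phi;
    att_cost : I -> formula I N Phi -> att_event -> nat;
    att_event_nonempty : 0 < #|att_event|;
    att_Q_equiv : forall i, equivalence_rel (att_Q i);
    att_Qstar_equiv : forall i, equivalence_rel (att_Qstar i);
    att_cost_top : forall i e, att_cost i Top e = 0;
    att_cost_uniform : forall i phi e e',
      att_Q i e e' || att_Qstar i e e' -> att_cost i phi e = att_cost i phi e'
  }.

Record att_action (I : finType) (N : nat) (Phi : countType) : Type :=
  AttAction {
    att_action_of :> att_action_model I N Phi;
    att_question : I -> formula I N Phi;
    att_point : att_event att_action_of
  }.

Definition Qstar_refined (I : finType) (N : nat) (Phi : countType)
    (A : att_action_model I N Phi) (phi : formula I N Phi) (i : I) :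
    rel (att_event A) :=
  fun e e' => att_Qstar i e e' &&
    `[< entails (att_pre e) phi <-> entails (att_pre e') phi >].

(* Subtraction on [nat] is truncated, hence is max(0, a - c). *)
Definition spend (N : nat) (a : 'I_N.+1) (c : nat) : 'I_N.+1 :=
  Ordinal (leq_ltn_trans (leq_subr c a) (ltn_ord a)).

(* The valuation of the update is inherited on all atoms; its values on
   attention atoms are irrelevant, see [att_atom]. *)
Definition att_update (I : finType) (N : nat) (Phi : countType)
    (M : att_structure I N Phi) (Y : att_action I N Phi) :
    att_structure I N Phi :=
  let WY : finType :=
    {x : att_world M * att_event Y | att_sat x.1 (att_pre x.2)} in
  {| att_world := WY;
     att_rel := fun i (x y : WY) =>
       let: (v, f) := val x in
       let: (u, g) := val y in
       att_rel i v u &&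
       (if att_level i v < att_cost i (att_question Y i) f
        then att_Q i f g || att_Qstar i f g
        else att_Q i f g || Qstar_refined (att_question Y i) i f g);
     att_val := fun p => [set x : WY | (val x).1 \in att_val M p];
     att_level := fun i (x : WY) =>
       let: (v, f) := val x in
       spend (att_level i v) (att_cost i (att_question Y i) f) |}.

(* The existential over applicability proofs encodes the convention that the
   result of a non-applicable update satisfies no formula. *)
Definition att_update_sat (I : finType) (N : nat) (Phi : countType)
    (M : att_structure I N Phi) (w : att_world M) (Y : att_action I N Phi)
    (phi : formula I N Phi) : Prop :=
  exists applicable : att_sat w (att_pre (att_point Y)),
    @att_sat I N Phi (att_update M Y)
      (exist _ (w, att_point Y) applicable) phi.

Record kripke_structure (I : finType) (N : nat) (Phi : countType) : Type :=
  KripkeStructure {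
    k_world : finType;
    k_rel : I -> rel k_world;
    k_val : atom I N Phi -> {set k_world}
  }.

Definition k_sat (I : finType) (N : nat) (Phi : countType)
    (K : kripke_structure I N Phi) (w : k_world K)
    (phi : formula I N Phi) : bool :=
  sat (k_rel (k := K)) (fun p v => v \in k_val K p) w phi.

Definition rendition (I : finType) (N : nat) (Phi : countType)
    (M : att_structure I N Phi) : kripke_structure I N Phi :=
  {| k_world := att_world M;
     k_rel := att_rel (a := M);
     k_val := fun p => [set v : att_world M | att_sat v (Atom p)] |}.

Record action_model (I : finType) (N : nat) (Phi : countType) : Type :=
  ActionModel {
    ep_event : finType;
    ep_Q : I -> rel ep_event;
    ep_pre : ep_event -> formula I N Phi;
    ep_post : ep_event -> atom I N Phi -> formula I N Phi;
    ep_event_nonempty : 0 < #|ep_event|;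
    ep_Q_equiv : forall i, equivalence_rel (ep_Q i)
  }.

Record ep_action (I : finType) (N : nat) (Phi : countType) : Type :=
  EpAction {
    ep_action_of :> action_model I N Phi;
    ep_point : ep_event ep_action_of
  }.

Definition product_update (I : finType) (N : nat) (Phi : countType)
    (K : kripke_structure I N Phi) (X : ep_action I N Phi) :
    kripke_structure I N Phi :=
  let WX : finType :=
    {x : k_world K * ep_event X | k_sat x.1 (ep_pre x.2)} in
  {| k_world := WX;
     k_rel := fun i (x y : WX) =>
       let: (v, f) := val x in
       let: (u, g) := val y in
       k_rel i v u && ep_Q i f g;
     k_val := fun p =>
       [set x : WX | k_sat (val x).1 (ep_post (val x).2 p)] |}.

Definition product_update_sat (I : finType) (N : nat) (Phi : countType)
    (K : kripke_structure I N Phi) (w : k_world K) (X : ep_action I N Phi)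
    (phi : formula I N Phi) : Prop :=
  exists applicable : k_sat w (ep_pre (ep_point X)),
    @k_sat I N Phi (product_update K X)
      (exist _ (w, ep_point X) applicable) phi.

Definition equivalent (I : finType) (N : nat) (Phi : countType)
    (Y : att_action I N Phi) (X : ep_action I N Phi) : Prop :=
  forall M : att_structure I N Phi, att_model M ->
  forall (w : att_world M) (phi : formula I N Phi),
    att_update_sat w Y phi <->
    product_update_sat (K := rendition M) w X phi.

(* Main.v *)
(* Postconditions may make (alpha_i < 0) true, whereas this atom is false in
   every attention state, in particular after every attention action. *)
Require Import Defs.
From mathcomp Require Import all_boot.

(** Postconditions rewrite attention atoms freely, whereas attention updates only change levels,
    from which these atoms are then read off. Setting every atom to [Top] thus yields
    [AttLt i ord0], out of reach of any [Y]. *)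

Definition unit_att_structure (I : finType) (N : nat) (Phi : countType) :
    att_structure I N Phi :=
  {| att_world := unit;
     att_rel := fun _ _ _ => true;
     att_val := fun _ => set0;
     att_level := fun _ _ => ord0 |}.

Lemma unit_att_structureP (I : finType) (N : nat) (Phi : countType) :
  att_model (unit_att_structure I N Phi).
Proof. by split=> //=; rewrite card_unit. Qed.

Definition constant_action (I : finType) (N : nat) (Phi : countType)
    (phi : formula I N Phi) : ep_action I N Phi.
Proof.
refine (@EpAction I N Phi
  (@ActionModel I N Phi unit (fun _ _ _ => true) (fun _ => Top)
     (fun _ _ => phi) _ _) tt).
- by rewrite card_unit.
- by [].
Defined.

Lemma att_update_sat_lt0 (I : finType) (N : nat) (Phi : countType)
    (M : att_structure I N Phi) (w : att_world M) (Y : att_action I N Phi)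
    (i : I) :
  ~ att_update_sat w Y (Atom (AttLt _ i ord0)).
Proof. by case=> applicable; rewrite /att_sat /= ltn0. Qed.

Theorem proposition21 (I : finType) (I_nonempty : 0 < #|I|) (N : nat)
    (Phi : countType) :
  exists X : ep_action I N Phi,
    forall Y : att_action I N Phi, ~ equivalent Y X.
Proof.
have [i _] := card_gt0P I_nonempty.
exists (constant_action I N Phi Top) => Y equivYX.
(* Any attention model would do: the constant action is applicable everywhere. *)
pose M := unit_att_structure I N Phi.
apply: (@att_update_sat_lt0 I N Phi M tt Y i).
apply/(equivYX M (unit_att_structureP I N Phi)).
(* Precondition and postcondition are both [Top]. *)
by exists isT; rewrite /k_sat /= inE.
Qed.
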